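(* Let $\Phi:\mathbb{R}^m\to[0,\infty]$. Then $\Phi$ is almost convex if and only if $\Phi\simeq\Phi^{\mathrm{conv}}$.
   Context: $\Phi:\mathbb{R}^m\to[0,\infty]$ is almost convex if there exists $\beta>0$ such that $\Phi(\beta(\alpha\xi+\alpha'\xi'))\le\alpha\Phi(\xi)+\alpha'\Phi(\xi')$ for all $\xi,\xi'\in\mathbb{R}^m$ and all $\alpha,\alpha'\ge0$ with $\alpha+\alpha'=1$ (convention $0\cdot\infty=0$). $\Phi^{\mathrm{conv}}$ denotes the greatest convex minorant of $\Phi$, i.e. the pointwise largest convex function $\mathbb{R}^m\to[0,\infty]$ that is $\le\Phi$. For $\Phi,\Psi:\mathbb{R}^m\to[0,\infty]$, $\Phi\simeq\Psi$ means that there exists $\beta>0$ such that $\Phi(\beta\xi)\le\Psi(\xi)\le\Phi(\xi/\beta)$ for all $\xi\in\mathbb{R}^m$. *)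

(* Defs.v *)
From HB Require Import structures.
From mathcomp Require Import all_boot all_order all_algebra.
From mathcomp Require Import boolp classical_sets reals ereal.

Set Implicit Arguments.
Unset Strict Implicit.
Unset Printing Implicit Defensive.

Import Order.TTheory GRing.Theory Num.Theory.

Local Open Scope classical_set_scope.
Local Open Scope ring_scope.
Local Open Scope ereal_scope.

(* Functions R^m -> [0, +oo] are functions 'rV[R]_m -> \bar R that are
   everywhere nonnegative.  In \bar R, 0 * +oo = 0. *)
Section almost_convex.
Context {R : realType} {m : nat}.
Implicit Types Phi Psi g : 'rV[R]_m -> \bar R.

Definition nneg_fun Phi : Prop := forall xi, 0 <= Phi xi.

Definition almost_convex Phi : Prop :=
  exists2 b : R, (0 < b)%R &
    forall (xi xi' : 'rV[R]_m) (a a' : R),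
      (0 <= a)%R -> (0 <= a')%R -> (a + a' = 1)%R ->
      Phi (b *: (a *: xi + a' *: xi'))%R <= a%:E * Phi xi + a'%:E * Phi xi'.

(* The library's convex_function only covers real-valued functions. *)
Definition econvex_fun Phi : Prop :=
  forall (xi xi' : 'rV[R]_m) (a a' : R),
    (0 <= a)%R -> (0 <= a')%R -> (a + a' = 1)%R ->
    Phi (a *: xi + a' *: xi')%R <= a%:E * Phi xi + a'%:E * Phi xi'.

Definition convex_minorant Phi : set ('rV[R]_m -> \bar R) :=
  [set g | [/\ nneg_fun g, econvex_fun g & forall xi, g xi <= Phi xi]].

(* The greatest convex minorant, as the pointwise supremum of all convex
   minorants; see greatest_convex_minorantP. *)
Definition greatest_convex_minorant Phi (xi : 'rV[R]_m) : \bar R :=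
  ereal_sup [set g xi | g in convex_minorant Phi].

Definition fun_equiv Phi Psi : Prop :=
  exists2 b : R, (0 < b)%R &
    forall xi : 'rV[R]_m, Phi (b *: xi)%R <= Psi xi <= Phi (b^-1 *: xi)%R.

Lemma greatest_convex_minorantP Phi : nneg_fun Phi ->
  convex_minorant Phi (greatest_convex_minorant Phi) /\
  (forall g, convex_minorant Phi g ->
     forall xi, g xi <= greatest_convex_minorant Phi xi).
Proof.
move=> Phi0.
have ub g : convex_minorant Phi g ->
    forall xi, g xi <= greatest_convex_minorant Phi xi.
  by move=> mg xi; apply: ereal_sup_ubound; exists g.
split=> //; split.
- move=> xi; apply: (ub (fun=> 0)); split=> // x y a b _ _ _.
  by rewrite !mule0 adde0.
- move=> x y a b a0 b0 ab; apply: ge_ereal_sup => _ [g mg <-].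
  have [_ cg _] := mg; apply: (le_trans (cg x y a b a0 b0 ab)).
  by apply: leeD; apply: lee_wpmul2l; rewrite ?lee_fin//; exact: ub.
- by move=> xi; apply: ge_ereal_sup => _ [g [_ _ gPhi] <-].
Qed.

End almost_convex.

Notation "Phi ^conv" := (greatest_convex_minorant Phi)
  (at level 2, format "Phi ^conv") : ereal_scope.
Notation "Phi ≃ Psi" := (fun_equiv Phi Psi) (at level 70) : ereal_scope.

(* Main.v *)
Require Import Defs.
From HB Require Import structures.
From mathcomp Require Import all_boot all_order all_algebra.
From mathcomp Require Import boolp classical_sets reals ereal.
Import Order.TTheory GRing.Theory Num.Theory.

(** If [Phi (b * xi) <= Phi^conv xi <= Phi (xi / b)], almost convexity with
    constant [b] is read off by applying the convexity inequality to
    [Phi^conv], which lies between the two sides.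

    For the converse, iterating almost convexity with constant [b] yields a
    Jensen inequality for [k + 1] points in which the argument of [Phi] is
    multiplied by [b ^ k].  This constant degenerates as the number of points
    grows, so the number of points has to be bounded, and this is what
    Caratheodory's theorem does: in the space [R^m x R], of dimension
    [m + 1], every point of the convex hull of the epigraph of [Phi] is a
    convex combination of at most [m + 2] points of the epigraph.  Hence
    [Phi (b ^ (m + 1) * xi) <= r] whenever [(xi, r)] is in that hull.

    The lower envelope of the hull, [xi |-> inf {r | (xi, r) in hull}], is
    convex because the hull is, lies below [Phi], and by the previous
    inequality lies above [xi |-> Phi (b ^ (m + 1) * xi)]; in particular it is
    nonnegative.  It is therefore a convex minorant of [Phi], and
    [Phi (b ^ (m + 1) * xi) <= Phi^conv xi].  The other half of the equivalence
    follows from [Phi^conv <= Phi] and [Phi (b ^ (m + 1) * xi) <= Phi xi], the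
    latter being almost convexity for two equal points, iterated. *)

(** * Convex combinations and Caratheodory's theorem *)

Section ConvexCombinations.
Local Open Scope classical_set_scope.
Local Open Scope ring_scope.
Context {R : realFieldType}.

Definition convex_comb {V : lmodType R} (n : nat) (A : set V) (v : V) : Prop :=
  exists a : 'I_n -> R, exists x : 'I_n -> V,
    [/\ forall i, 0 <= a i, \sum_i a i = 1, forall i, A (x i)
      & v = \sum_i a i *: x i].

Definition convex_hull {V : lmodType R} (A : set V) : set V :=
  [set v | exists n, convex_comb n A v].

Lemma convex_comb1 {V : lmodType R} (A : set V) v : A v -> convex_comb 1 A v.
Proof.
move=> Av; exists (fun=> 1), (fun=> v).
by split=> //; rewrite big_ord1 // scale1r.
Qed.

Lemma convex_hull_convex {V : lmodType R} (A : set V) v w (a b : R) :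
  0 <= a -> 0 <= b -> a + b = 1 ->
  convex_hull A v -> convex_hull A w -> convex_hull A (a *: v + b *: w).
Proof.
move=> a0 b0 ab [n [c [x [c0 c1 Ax ->]]]] [k [d [y [d0 d1 Ay ->]]]].
exists (n + k)%N.
exists (fun i => match split i with inl j => a * c j | inr j => b * d j end).
exists (fun i => match split i with inl j => x j | inr j => y j end).
have spl j : split (lshift k j) = inl j := unsplitK (inl j).
have spr j : split (rshift n j) = inr j := unsplitK (inr j).
split.
- by move=> i; case: split => j; rewrite mulr_ge0.
- rewrite big_split_ord /=; under eq_bigr do rewrite spl.
  under [X in _ + X]eq_bigr do rewrite spr.
  by rewrite -!mulr_sumr c1 d1 !mulr1.
- by move=> i; case: split => j.
- rewrite big_split_ord /= !scaler_sumr; congr (_ + _); apply: eq_bigr => i _.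
    by rewrite spl scalerA.
  by rewrite spr scalerA.
Qed.

(** Separating one point from a convex combination, which is what inductions on
    the number of points consume.  If that point carries the whole weight, the
    rest cannot be renormalised and any point may serve as [w]. *)
Lemma convex_comb_recl {V : lmodType R} n (A : set V) v :
  convex_comb n.+2 A v ->
  exists a : R, exists x, exists w,
    [/\ 0 <= a <= 1, A x, convex_comb n.+1 A w & v = a *: x + (1 - a) *: w].
Proof.
move=> [a [x [a0 a1 Ax ->]]].
have s1 : 1 - a ord0 = \sum_i a (lift ord0 i).
  by rewrite -a1 big_ord_recl addrC addKr.
have s0 : 0 <= 1 - a ord0 by rewrite s1 sumr_ge0.
have a01 : 0 <= a ord0 <= 1 by rewrite a0 -subr_ge0.
rewrite big_ord_recl; exists (a ord0), (x ord0).
have [z|nz] := eqVneq (1 - a ord0) 0.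
  exists (x ord0); split=> //.
    exists (fun i => (i == ord0)%:R), (fun=> x ord0); split=> [i||//|].
    - exact: ler0n.
    - by rewrite big_ord_recl big1 ?addr0.
    - by rewrite big_ord_recl big1 ?addr0 ?scale1r // => i _; rewrite scale0r.
  rewrite z scale0r big1 // => i _; rewrite (_ : a _ = 0) ?scale0r //.
  rewrite z in s1.
  exact: (psumr_eq0P (fun i _ => a0 (lift ord0 i)) (esym s1)).
exists ((1 - a ord0)^-1 *: \sum_i a (lift ord0 i) *: x (lift ord0 i)).
split=> //; last by rewrite scalerA divff // scale1r.
exists (fun i => (1 - a ord0)^-1 * a (lift ord0 i)), (fun i => x (lift ord0 i)).
split=> //.
- by move=> i; rewrite mulr_ge0 // invr_ge0.
- by rewrite -mulr_sumr -s1 mulVf.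
- by rewrite scaler_sumr; apply: eq_bigr => i _; rewrite scalerA.
Qed.

(** Affine dependence of [x] is linear dependence of the vectors [(1, x i)],
    which live in a space of dimension [(dim V).+1]. *)
Lemma affine_dependence {V : vectType R} n (x : 'I_n -> V) :
  ((dim V).+1 < n)%N ->
  exists c : 'I_n -> R,
    [/\ \sum_i c i = 0, \sum_i c i *: x i = 0 & exists i, c i != 0].
Proof.
move=> ltVn; pose X := [tuple ((1, x i) : R^o * V) | i < n].
have nfree : ~ free X.
  rewrite /free => /eqP dimX; move: ltVn.
  rewrite ltnNge -(size_tuple X) -dimX -[(dim V).+1](dimvf (R^o * V)%type).
  by rewrite dimvS ?subvf.
apply: contrapT => nodep; apply: nfree; apply/freeP => c cX i.
apply/eqP/negPn/negP => ci; apply: nodep; exists c.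
have cXi : \sum_i c i *: ((1, x i) : R^o * V) = 0.
  by rewrite -[RHS]cX; apply: eq_bigr => l _; rewrite nth_mktuple.
have c1 := congr1 (@fst _ _) cXi; have c2 := congr1 (@snd _ _) cXi.
split; last by exists i.
- rewrite -[RHS]c1 (raddf_sum (@fst R^o V)).
  by apply: eq_bigr => l _; rewrite /= [RHS]mulr1.
- by rewrite -[RHS]c2 (raddf_sum (@snd R^o V)).
Qed.

(** Moving the weights along an affine dependence [c], in the direction that
    decreases the weights where [c] is positive, leaves the combination
    unchanged; it can be continued until some weight vanishes. *)
Lemma convex_comb_reduce {V : vectType R} n (A : set V) v :
  ((dim V).+1 < n.+1)%N -> convex_comb n.+1 A v -> convex_comb n A v.
Proof.
move=> ltVn [a [x [a0 a1 Ax ->]]].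
have [c [c0 cx [i0 ci0]]] := affine_dependence n.+1 x ltVn.
have [j cj] : exists j, 0 < c j.
  apply: contrapT => nc; move/eqP: ci0; apply; apply/eqP; rewrite -oppr_eq0.
  have cN i : true -> 0 <= - c i.
    by move=> _; rewrite oppr_ge0 leNgt; apply/negP => ci; apply: nc; exists i.
  by apply/eqP/(psumr_eq0P cN) => //; rewrite sumrN c0 oppr0.
(* The smallest ratio is the step at which the first weight vanishes. *)
case: (@arg_minP _ _ _ j (fun i => 0 < c i) (fun i => a i / c i) cj) => k ck kmin.
pose d i := a i - a k / c k * c i.
have dk : d k = 0 by rewrite /d divfK ?subrr // gt_eqF.
have d0 i : 0 <= d i.
  rewrite /d subr_ge0; have [ci|ci] := ltP 0 (c i).
    by rewrite -ler_pdivlMr // kmin.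
  apply: (le_trans _ (a0 i)); apply: mulr_ge0_le0 => //.
  by rewrite divr_ge0 // ltW.
have d1 : \sum_i d i = 1 by rewrite sumrB a1 -mulr_sumr c0 mulr0 subr0.
have dx : \sum_i a i *: x i = \sum_i d i *: x i.
  under [RHS]eq_bigr do rewrite scalerBl -scalerA.
  by rewrite sumrB -scaler_sumr cx scaler0 subr0.
exists (fun i => d (lift k i)), (fun i => x (lift k i)); split=> //.
- by move: d1; rewrite (bigD1_ord k) //= dk add0r.
- by rewrite dx (bigD1_ord k) //= dk scale0r add0r.
Qed.

Theorem caratheodory {V : vectType R} (A : set V) v :
  convex_hull A v -> exists2 k, (k <= dim V)%N & convex_comb k.+1 A v.
Proof.
move=> [n]; elim: n => [[a [x [_ /eqP]]]|n IH].
  by rewrite big_ord0 eq_sym oner_eq0.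
move=> vn; have [le_nV|lt_Vn] := leqP n (dim V); first by exists n.
by apply: IH; apply: convex_comb_reduce.
Qed.

End ConvexCombinations.

(** * Epigraphs and lower envelopes *)

Section Epigraph.
Local Open Scope classical_set_scope.
Local Open Scope ereal_scope.
Context {R : realType} {m : nat}.
Implicit Types (Phi : 'rV[R]_m -> \bar R) (E : set ('rV[R]_m * R^o)).

(** Real heights only: this keeps the epigraph inside a vector space, and a point
    where [Phi] is infinite has nothing above it. *)
Definition epigraph Phi : set ('rV[R]_m * R^o) := [set p | Phi p.1 <= p.2%:E].

Definition lower_envelope E (xi : 'rV[R]_m) : \bar R :=
  ereal_inf [set r%:E | r in [set r : R | E (xi, r)]].

Lemma lower_envelope_lb E xi (y : \bar R) :
  (forall r : R, E (xi, r) -> y <= r%:E) -> y <= lower_envelope E xi.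
Proof. by move=> yE; apply: le_ereal_inf_tmp => _ [r Er <-]; apply: yE. Qed.

Lemma lower_envelope_le E xi (r : R) : E (xi, r) -> lower_envelope E xi <= r%:E.
Proof. by move=> Er; apply: ereal_inf_lbound; exists r. Qed.

Lemma lower_envelope_epigraph_le Phi E : nneg_fun Phi ->
  epigraph Phi `<=` E -> forall xi, lower_envelope E xi <= Phi xi.
Proof.
move=> Phi0 sub xi; case eqPhi: (Phi xi) (Phi0 xi) => [r| |] // _.
  by apply: lower_envelope_le; apply: sub; rewrite /epigraph /= eqPhi.
by rewrite leey.
Qed.

(** Nearly optimal heights over [xi] and [xi'] combine, by convexity of [E], to a
    height over the combination of [xi] and [xi'].  Nonnegativity rules out the
    undefined sums of opposite infinities. *)
Lemma lower_envelope_convex E : nneg_fun (lower_envelope E) ->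
  (forall p q (a b : R), (0 <= a)%R -> (0 <= b)%R -> (a + b = 1)%R ->
     E p -> E q -> E (a *: p + b *: q)%R) ->
  econvex_fun (lower_envelope E).
Proof.
move=> E0 Econv xi xi' a b; rewrite le_eqVlt => /predU1P[<- _|a0].
  by rewrite add0r => ->; rewrite !scale0r !scale1r add0r mul0e mul1e add0e.
rewrite le_eqVlt => /predU1P[<-|b0].
  by rewrite addr0 => ->; rewrite !scale0r !scale1r addr0 mul0e mul1e adde0.
move=> ab.
case eu: (lower_envelope E xi) (E0 xi) => [u| |] // u0; last first.
  rewrite gt0_muley ?lte_fin // addye ?leey //.
  by rewrite gt_eqF // (lt_le_trans ltNy0) // mule_ge0 ?E0 // lee_fin ltW.
case ev: (lower_envelope E xi') (E0 xi') => [v| |] // v0; last first.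
  by rewrite gt0_muley ?lte_fin // addey ?leey.
apply/lee_addgt0Pr => e e0.
have near zeta w : lower_envelope E zeta = w%:E ->
    exists2 r : R, E (zeta, r) & (r < w + e)%R.
  move=> ew; have [|_ [r Er <-]] := @lb_ereal_inf_adherent _
      [set r%:E | r in [set r : R | E (zeta, r)]] _ e0.
    by rewrite -/(lower_envelope E zeta) ew.
  by rewrite -/(lower_envelope E zeta) ew -EFinD lte_fin; exists r.
have [r Er ru] := near _ _ eu; have [s Es sv] := near _ _ ev.
apply: (le_trans (lower_envelope_le _ _ _
  (Econv _ _ _ _ (ltW a0) (ltW b0) ab Er Es))).
rewrite -!EFinM -!EFinD lee_fin.
have -> : (a * u + b * v + e = a * (u + e) + b * (v + e))%R.
  by rewrite !mulrDr addrACA -mulrDl ab mul1r.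
by apply: lerD; rewrite ler_pM2l // ltW.
Qed.

End Epigraph.

(** * Almost convex functions *)

Section AlmostConvex.
Local Open Scope classical_set_scope.
Local Open Scope ereal_scope.
Context {R : realType} {m : nat} (Phi : 'rV[R]_m -> \bar R) (b : R).
Hypothesis Phi0 : nneg_fun Phi.
Hypothesis Phib : forall (xi xi' : 'rV[R]_m) (a a' : R),
  (0 <= a)%R -> (0 <= a')%R -> (a + a' = 1)%R ->
  Phi (b *: (a *: xi + a' *: xi'))%R <= a%:E * Phi xi + a'%:E * Phi xi'.

Lemma almost_convex_scale_le n xi : Phi (b ^+ n *: xi)%R <= Phi xi.
Proof.
elim: n => [|n IH]; first by rewrite expr0 scale1r.
rewrite exprS -scalerA; apply: le_trans IH.
have := Phib (b ^+ n *: xi)%R 0%R 1%R 0%R ler01 (lexx _) (addr0 _).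
by rewrite scale1r scale0r addr0 mul1e mul0e adde0.
Qed.

(** Each point beyond the first costs one application of almost convexity, hence
    one factor [b]. *)
Lemma almost_convex_jensen n p :
  convex_comb n.+1 (epigraph Phi) p -> Phi (b ^+ n *: p.1)%R <= p.2%:E.
Proof.
elim: n p => [|n IH] p.
  move=> [a [x [_ a1 Ax ->]]]; move: a1; rewrite !big_ord1 => ->.
  by rewrite expr0 !scale1r; apply: Ax.
move=> /convex_comb_recl[a [x [w [/andP[a0 a1] Ax /IH wn ->]]]] /=.
have b0 : (0 <= 1 - a)%R by rewrite subr_ge0.
rewrite exprS -scalerA scalerDr !(scalerA (b ^+ n)) ![(b ^+ n * _)%R]mulrC.
rewrite -!scalerA; apply: (le_trans (Phib _ _ _ _ a0 b0 (subrKC _ _))).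
rewrite [leRHS]EFinD; apply: leeD.
  by rewrite EFinM lee_wpmul2l ?lee_fin // (le_trans (almost_convex_scale_le _ _)).
by rewrite EFinM lee_wpmul2l ?lee_fin.
Qed.

(** Caratheodory's theorem makes the loss in Jensen's inequality uniform; the
    exponent is the dimension of [R^m x R]. *)
Lemma almost_convex_hull_epigraph p :
  convex_hull (epigraph Phi) p ->
  Phi (b ^+ dim ('rV[R]_m * R^o)%type *: p.1)%R <= p.2%:E.
Proof.
move=> /caratheodory[k le_kV /almost_convex_jensen]; apply: le_trans.
by rewrite -(subnK le_kV) exprD -scalerA almost_convex_scale_le.
Qed.

Lemma almost_convex_le_conv xi :
  Phi (b ^+ dim ('rV[R]_m * R^o)%type *: xi)%R <= Phi^conv xi.
Proof.
pose g := lower_envelope (convex_hull (epigraph Phi)).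
have Phig zeta : Phi (b ^+ dim ('rV[R]_m * R^o)%type *: zeta)%R <= g zeta.
  by apply: lower_envelope_lb => r; apply: almost_convex_hull_epigraph.
have g0 : nneg_fun g by move=> zeta; apply: le_trans (Phig zeta).
apply: (le_trans (Phig xi)).
apply: (greatest_convex_minorantP Phi0).2; split=> //.
- by apply: lower_envelope_convex => // *; apply: convex_hull_convex.
- apply: lower_envelope_epigraph_le => // p Ep.
  by exists 1%N; apply: convex_comb1.
Qed.

End AlmostConvex.

Local Open Scope ereal_scope.

Theorem corollary2p4 (R : realType) (m : nat) (Phi : 'rV[R]_m -> \bar R)
    (Phi0 : nneg_fun Phi) :
  almost_convex Phi <-> Phi ≃ Phi^conv.
Proof.
have [[_ conv_cvx conv_le] _] := greatest_convex_minorantP Phi0.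
split=> [[b b0 Phib]|[b b0 Phib]].
  have bn0 : (0 < b ^+ dim ('rV[R]_m * R^o)%type)%R by rewrite exprn_gt0.
  exists (b ^+ dim ('rV[R]_m * R^o)%type)%R => // xi.
  rewrite almost_convex_le_conv //=; apply: (le_trans (conv_le xi)).
  rewrite -{1}[xi](@scalerKV _ _ (b ^+ dim ('rV[R]_m * R^o)%type)%R) ?gt_eqF //.
  exact: almost_convex_scale_le.
exists b => // xi xi' a a' a0 a'0 aa'.
have /andP[+ _] := Phib (a *: xi + a' *: xi')%R; move/le_trans; apply.
apply: (le_trans (conv_cvx _ _ _ _ a0 a'0 aa')).
by apply: leeD; apply: lee_wpmul2l; rewrite ?lee_fin ?conv_le.
Qed.
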